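(* Let $X$ be a midconvex subset of a uniquely 2-divisible abelian group $(G,+)$, and let $(Y,+,d)$ be a complete metric abelian group equipped with the ordering $\leq_S$ generated by a closed pointed additively controllable subsemigroup $S\subseteq Y$. Let $n\geq 2$ and let $a_{1},\ldots,a_{n}:G\to G$ and $A_{1},\ldots,A_{n}:Y\to Y$ be two families of additive maps such that: (i) $a_i\circ a_j=a_j\circ a_i$ and $A_i\circ A_j=A_j\circ A_i$ for all $i,j\in\{1,\dots,n\}$; (ii) $a_{1}+\dots+a_{n}=\mathrm{id}_G$ and $A_{1}+\dots+A_{n}=\mathrm{id}_Y$; (iii) $a_{1}(X)+\dots+a_{n}(X)\subseteq X$; (iv) $A_i$ is bijective with $A_i(S)=S$ for all $i\in\{1,\dots,n\}$. Let $f:X\to Y$ satisfy, for all $x_1,\ldots,x_n\in X$, $$f\big(a_{1}(x_{1})+\dots+a_{n}(x_{n})\big)\leq_{S}A_{1}\big(f(x_{1})\big)+\dots+A_{n}\big(f(x_{n})\big).$$ Then, for every $p\in\operatorname{ri}(X)$, there exists a function $g:X\to Y$ such that $g(x)\leq_S f(x)$ for all $x\in X$, $g(p)=f(p)$ and, for all $x_1,\ldots,x_n\in X$, $$g\big(a_{1}(x_{1})+\dots+a_{n}(x_{n})\big)=A_{1}\big(g(x_{1})\big)+\dots+A_{n}\big(g(x_{n})\big).$$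
   Context: An abelian group $(G,+)$ is uniquely 2-divisible if for every $x\in G$ there is a unique $y\in G$ with $2y=x$, denoted $\frac12x$; $\frac1{2^m}x$ is defined inductively. A subset $X\subseteq G$ is midconvex if $\frac12(x+y)\in X$ for all $x,y\in X$. A point $p\in X$ is a relative algebraic interior point of $X$ if for all $x\in X$ there exists a positive integer $m$ such that $p+\frac1{2^m}(p-x)\in X$; $\operatorname{ri}(X)$ is the set of such points. A metric abelian group $(Y,+,d)$ is an abelian group with a translation-invariant metric $d$ (i.e. $d(x+z,y+z)=d(x,y)$); complete means $(Y,d)$ is complete. Put $\|x\|_d:=d(x,0)$. A subsemigroup $S$ of $Y$ is pointed if $0\in S$; it is additively controllable if there exists a continuous additive function $a:Y\to\mathbb{R}$ with $\|y\|_d\leq a(y)$ for all $y\in S$ (this implies $S\cap(-S)\subseteq\{0\}$). The ordering generated by $S$ is $x\leq_S y$ iff $y-x\in S$. *)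

(* Defs.v *)
From HB Require Import structures.
From mathcomp Require Import all_boot all_order all_algebra.
From mathcomp Require Import all_classical all_reals all_analysis.

Set Implicit Arguments.
Unset Strict Implicit.
Unset Printing Implicit Defensive.

Import Order.TTheory GRing.Theory Num.Theory.
Import numFieldNormedType.Exports.

Local Open Scope classical_set_scope.
Local Open Scope ring_scope.

Definition uniquely_2_divisible (G : zmodType) : Prop :=
  forall x : G, exists! y : G, y *+ 2 = x.

(* The unique y with 2 y = x when G is uniquely 2-divisible; the default value
   0 is only reached when x has no half. *)
Definition ghalf (G : zmodType) (x : G) : G := xget 0 [set y | y *+ 2 = x].

Definition dyadic (G : zmodType) (m : nat) (x : G) : G := iter m (@ghalf G) x.

Definition midconvex (G : zmodType) (X : set G) : Prop :=
  forall x y : G, X x -> X y -> X (ghalf (x + y)).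

Definition ri (G : zmodType) (X : set G) : set G :=
  [set p | X p /\
     forall x : G, X x -> exists2 m : nat, (0 < m)%N & X (p + dyadic m (p - x))].

(* A metric abelian group: an abelian group with a translation-invariant metric.
   It is a plain record because HB rejects a join of Zmodule and Metric declared
   after pseudoMetricNormedZmodType.  The latter is too restrictive here: its
   norm satisfies `|x *+ n| = `|x| *+ n. *)
Record metricZmodType (R : numFieldType) := MetricZmod {
  metric_zmod : zmodType;
  gdist : metric_zmod -> metric_zmod -> R;
  gdistxx : forall x, gdist x x = 0;
  gdist_positivity : forall x y, gdist x y = 0 -> x = y;
  gdist_sym : forall x y, gdist x y = gdist y x;
  gdist_triangle : forall y x z, gdist x z <= gdist x y + gdist y z;
  gdistDr : forall z x y, gdist (x + z) (y + z) = gdist x y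
}.

(* The carrier, as the key under which the group structure and the metric
   (hence its uniformity and its topology) are both inferred. *)
Definition metric_carrier (R : numFieldType) (Y : metricZmodType R) : Type :=
  metric_zmod Y.
Coercion metric_carrier : metricZmodType >-> Sortclass.

HB.instance Definition _ (R : numFieldType) (Y : metricZmodType R) :=
  GRing.Zmodule.on (metric_carrier Y).
HB.instance Definition _ (R : numFieldType) (Y : metricZmodType R) :=
  isMetric.Build R (metric_carrier Y)
    (@gdistxx R Y) (@gdist_positivity R Y) (@gdist_sym R Y)
    (@gdist_triangle R Y).
HB.instance Definition _ (R : numFieldType) (Y : metricZmodType R) :=
  isPointed.Build (metric_carrier Y) 0.

(* The axiom of the library's completeType. *)
Definition complete_space (Y : puniformType) : Prop :=
  forall F : set_system Y, ProperFilter F -> cauchy F -> cvg F.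

Definition dnorm (R : numFieldType) (Y : metricZmodType R) (x : Y) : R :=
  mdist x 0.

Definition subsemigroup (Y : zmodType) (S : set Y) : Prop :=
  forall x y : Y, S x -> S y -> S (x + y).

Definition additively_controllable (R : realType) (Y : metricZmodType R)
    (S : set Y) : Prop :=
  exists2 a : {additive Y -> R},
    continuous a & forall y : Y, S y -> dnorm y <= a y.

Definition sg_le (Y : zmodType) (S : set Y) (x y : Y) : Prop := S (y - x).

(* Main.v *)
(* Let g be a minimal element, for the pointwise order on X, among the functions
   below f which satisfy the same convexity inequality and agree with f at p. If
   all entries of x but the i-th are fixed, then
     g'(x) = A_i^-1 (g (sum_j a_j x_j) - sum_(j != i) A_j (g x_j))
   is a function of x_i which is below g and satisfies the inequality again; it
   takes the value g p at p when equality holds with the i-th entry replaced by p.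
   Then g' = g by minimality, and the equality propagates from x = (p, .., p) to
   arbitrary x, one entry at a time.
   Zorn's lemma yields g: chains bounded below have infima in Y, and all the
   competitors admit a common lower bound at each point, since the inequality
   makes them midconvex and p is a relative algebraic interior point. *)
Require Import Defs.
From HB Require Import structures.
From mathcomp Require Import all_boot all_order all_algebra.
From mathcomp Require Import all_classical all_reals all_analysis.

Set Implicit Arguments.
Unset Strict Implicit.
Unset Printing Implicit Defensive.

Import Order.TTheory GRing.Theory Num.Theory.
Import numFieldNormedType.Exports.

Local Open Scope classical_set_scope.
Local Open Scope ring_scope.

(** * Groups ordered by a subsemigroup *)

Section OrderedGroup.
Context (Y : zmodType) (S : set Y).
Hypotheses (Sadd : subsemigroup S) (S0 : S 0).

Lemma sg_lexx x : sg_le S x x.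
Proof. by rewrite /sg_le subrr. Qed.

Lemma sg_le_trans y x z : sg_le S x y -> sg_le S y z -> sg_le S x z.
Proof. by move=> xy yz; rewrite /sg_le -(subrKA y) addrC; exact: Sadd. Qed.

Lemma sg_leD x y z t :
  sg_le S x y -> sg_le S z t -> sg_le S (x + z) (y + t).
Proof. by move=> xy zt; rewrite /sg_le opprD addrACA; exact: Sadd. Qed.

Lemma sg_leD2r z x y : sg_le S (x + z) (y + z) <-> sg_le S x y.
Proof. by rewrite /sg_le opprD addrACA subrr addr0. Qed.

Lemma sg_leBDr x y z : sg_le S (x - y) z <-> sg_le S x (z + y).
Proof. by rewrite /sg_le opprB addrA. Qed.

Lemma sg_leMn k x y : sg_le S x y -> sg_le S (x *+ k) (y *+ k).
Proof.
move=> xy; elim: k => [|k IHk]; first by rewrite !mulr0n; exact: sg_lexx.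
by rewrite !mulrS; exact: sg_leD.
Qed.

Lemma sg_le_sum (I : Type) (r : seq I) (P : pred I) (F H : I -> Y) :
  (forall i, P i -> sg_le S (F i) (H i)) ->
  sg_le S (\sum_(i <- r | P i) F i) (\sum_(i <- r | P i) H i).
Proof.
move=> FH; elim/big_rec2: _ => [|i y z Pi yz]; first exact: sg_lexx.
by apply: sg_leD => //; exact: FH.
Qed.

Lemma sg_le_automorphism (B : {additive Y -> Y}) : bijective B -> B @` S = S ->
  forall x y, sg_le S (B x) (B y) <-> sg_le S x y.
Proof.
move=> Bbij BS x y; rewrite /sg_le -raddfB -{1}BS; split=> [[z Sz]|Sz].
  by move=> /(bij_inj Bbij) <-.
by exists (y - x).
Qed.

Definition sg_inf (C : set Y) (m : Y) : Prop :=
  (forall y, C y -> sg_le S m y) /\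
  (forall l, (forall y, C y -> sg_le S l y) -> sg_le S l m).

(** Together with antisymmetry of the order, this is all that the construction of g takes from the
    metric. *)
Definition sg_chain_complete : Prop := forall C : set Y,
  C !=set0 -> total_on C (sg_le S) ->
  (exists l, forall y, C y -> sg_le S l y) -> exists m, sg_inf C m.

End OrderedGroup.

(** * Metric abelian groups: antisymmetry and infima of chains *)

Section MetricGroup.
Context (R : realType) (Y : metricZmodType R).
Implicit Types x y z : Y.

Lemma mdistDr z x y : mdist (x + z) (y + z) = mdist x y :> R.
Proof. exact: gdistDr. Qed.

Lemma mdist_dnorm x y : mdist x y = dnorm (x - y) :> R.
Proof. by rewrite /dnorm -(mdistDr y (x - y)) subrK add0r. Qed.

Lemma mdistN x y : mdist (- x) (- y) = mdist x y :> R.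
Proof. by rewrite -(mdistDr (x + y)) addKr addrCA addNr addr0 metric_sym. Qed.

Lemma mdistBl z x y : mdist (z - x) (z - y) = mdist x y :> R.
Proof. by rewrite ![z - _]addrC mdistDr mdistN. Qed.

Lemma mdistBr z x y : mdist (x - z) (y - z) = mdist x y :> R.
Proof. exact: mdistDr. Qed.

Context (S : set Y).
Hypotheses (Sadd : subsemigroup S) (S0 : S 0).

(** The controlling functional bounds the distance of x and y by both a(y - x) and its opposite, so
    the distance vanishes. *)
Lemma controllable_le_anti : additively_controllable S ->
  forall x y, sg_le S x y -> sg_le S y x -> x = y.
Proof.
move=> [a _ Sa] x y xy yx; apply: (@mdist_positivity R).
have := Sa _ xy; have := Sa _ yx; rewrite -mdist_dnorm -[y - x]opprB raddfN /=.
have := mdist_ge0 (y - x) 0; rewrite /dnorm -opprB => h0 h1 h2.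
apply/eqP; rewrite eq_le mdist_ge0 andbT; apply: (le_trans h1).
by rewrite -oppr_ge0; apply: le_trans h2; rewrite mdist_ge0.
Qed.

(* The tails of a chain bounded below form a Cauchy filter, because the
   controlling functional is a decreasing bounded function along the chain. *)
Lemma controllable_chain_complete : complete_space Y -> closed S ->
  additively_controllable S -> sg_chain_complete S.
Proof.
move=> Ycomplete Sclosed [a _ Sa] C [c0 Cc0] Ctot [l Cl].
pose tail c := [set z | C z /\ sg_le S z c].
pose F := filter_from C tail.
have FF : ProperFilter F.
  apply: filter_from_proper => [|c Cc]; last first.
    by exists c; split=> //; exact: sg_lexx.
  apply: filter_from_filter => [|c d Cc Cd]; first by exists c0.
  have [cd|dc] := Ctot _ _ Cc Cd; [exists c|exists d] => // z [Cz zc].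
    by split; split=> //; exact: sg_le_trans cd.
  by split; split=> //; exact: sg_le_trans dc.
have a_le x y : sg_le S x y -> mdist x y <= a y - a x.
  by move=> xy; rewrite metric_sym mdist_dnorm -raddfB; exact: Sa.
have a_mono x y : sg_le S x y -> a x <= a y.
  by move=> /a_le h; rewrite -subr_ge0; apply: le_trans h; exact: mdist_ge0.
have infC : has_inf [set a y | y in C].
  split; first by exists (a c0), c0.
  by exists (a l) => _ [y Cy <-]; exact/a_mono/Cl.
have Fcauchy : cauchy F.
  apply: cauchy_exP => e e0.
  (* Once a(c) is within e of the infimum of a on C, the tail below c lies in the ball of radius e
     around c. *)
  have [_ [c Cc <-] c_lt] := inf_adherent e0 infC.
  exists c, c => // z [Cz zc]; rewrite ballEmdist /= metric_sym.
  apply: le_lt_trans (a_le _ _ zc) _.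
  rewrite ltrBlDl (lt_le_trans c_lt)// lerD2r.
  by apply: ge_inf; [exact: infC.2|exists z].
have /cvg_ex[m Fm] := Ycomplete _ FF Fcauchy.
have near_m (e : R) c : 0 < e -> C c -> exists2 z, tail c z & mdist m z < e.
  move=> e0 Cc; have Fb : F (ball m e) by apply: Fm; exact: nbhsx_ballx.
  have /filter_ex[z [cz]] : F (tail c `&` ball m e).
    by apply: filterI => //; exists c.
  by rewrite ballEmdist /=; exists z.
(* Both properties of the infimum m are memberships in the closed set S: y - m and m - d are limits
   of y - z and z - d with z in the tails. *)
have adherent u :
    (forall e : R, 0 < e -> exists2 v, S v & mdist u v < e) -> S u.
  move=> Su; apply: Sclosed => B /nbhs_ballP[e /= e0 uB].
  have [v Sv uv] := Su e e0; exists v; split=> //; apply: uB.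
  by rewrite ballEmdist.
exists m; split=> [y Cy|d dC]; apply: adherent => e e0.
  have [z [_ zy] mz] := near_m e y e0 Cy.
  by exists (y - z) => //; rewrite mdistBl.
have [z [Cz _] mz] := near_m e c0 e0 Cc0.
by exists (z - d); [exact: dC|rewrite mdistBr].
Qed.

End MetricGroup.

(** * Halving in uniquely 2-divisible groups *)

Section Halving.
Context (G : zmodType) (G2 : uniquely_2_divisible G).
Implicit Types x y : G.

Lemma ghalfK x : ghalf x *+ 2 = x.
Proof.
rewrite /ghalf; case: xgetP => [y _ //|noy].
by have [y [xy _]] := G2 x; case: (noy y).
Qed.

Lemma mulr2_inj x y : x *+ 2 = y *+ 2 -> x = y.
Proof.
have [z [_ z_uniq]] := G2 (y *+ 2).
by move=> /z_uniq <-; rewrite (z_uniq y).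
Qed.

Lemma ghalfN x : ghalf (- x) = - ghalf x.
Proof. by apply: mulr2_inj; rewrite mulNrn !ghalfK. Qed.

Lemma dyadicN m x : dyadic m (- x) = - dyadic m x.
Proof. by elim: m => //= m ->; rewrite ghalfN. Qed.

(** Exhibits each point p + [dyadic m.+1 x] as the midpoint of p + [dyadic m x] and p. *)
Lemma ghalf_midr x y : ghalf (y + x + y) = y + ghalf x.
Proof. by apply: mulr2_inj; rewrite mulrnDl !ghalfK mulr2n addrAC. Qed.

End Halving.

(** * The convexity inequality and changes of a single entry *)

Definition subaffine (G Y : zmodType) (n : nat) (S : set Y) (X : set G)
    (a : 'I_n -> {additive G -> G}) (A : 'I_n -> {additive Y -> Y})
    (g : G -> Y) : Prop :=
  forall x : 'I_n -> G, (forall i, X (x i)) ->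
    sg_le S (g (\sum_(i < n) a i (x i))) (\sum_(i < n) A i (g (x i))).

(** The maps [c j] are arbitrary so that both [a j] and the non-additive [A j \o g] are covered. *)
Lemma sum_update (V W : zmodType) (n : nat) (c : 'I_n -> V -> W)
    (t : 'I_n -> V) (i : 'I_n) (x : V) :
  \sum_j c j ([eta t with i |-> x] j) = \sum_j c j (t j) + (c i x - c i (t i)).
Proof.
rewrite (bigD1 i)//= eqxx [in RHS](bigD1 i)//= [c i (t i) + _]addrC -addrA.
rewrite subrKC addrC; congr (_ + _).
by apply: eq_bigr => j /negPf ->.
Qed.

Lemma update_in (V : Type) (I : eqType) (X : set V) (t : I -> V) i x :
  X x -> (forall j, X (t j)) -> forall j, X ([eta t with i |-> x] j).
Proof. by move=> Xx Xt j /=; case: eqP. Qed.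
Arguments update_in {V I X t} i {x}.

(** * Consequences of the convexity inequality: midconvexity, lower bounds and infima of chains *)

Section Subaffine.
Context (G Y : zmodType) (G2 : uniquely_2_divisible G).
Context (X : set G) (Xmid : midconvex X).
Context (S : set Y) (Sadd : subsemigroup S) (S0 : S 0).
Hypothesis S_anti : forall x y, sg_le S x y -> sg_le S y x -> x = y.
Hypothesis S_complete : sg_chain_complete S.
Context (n : nat) (n2 : (2 <= n)%N).
Context (a : 'I_n -> {additive G -> G}) (A : 'I_n -> {additive Y -> Y}).
Hypothesis a_comm : forall i j x, a i (a j x) = a j (a i x).
Hypothesis A_comm : forall i j y, A i (A j y) = A j (A i y).
Hypothesis a_sum : forall x, \sum_(i < n) a i x = x.
Hypothesis A_sum : forall y, \sum_(i < n) A i y = y.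
Hypothesis aX : forall x : 'I_n -> G,
  (forall i, X (x i)) -> X (\sum_(i < n) a i (x i)).
Hypothesis A_bij : forall i, bijective (A i).
Hypothesis A_S : forall i, A i @` S = S.

Let A_le i x y : sg_le S (A i x) (A i y) <-> sg_le S x y.
Proof. exact: sg_le_automorphism. Qed.

(** As the a_j commute and sum to the identity, taking combinations commutes with the affine map z
    -> c + a_i z. *)
Lemma comb_sum (c : G) i (x : 'I_n -> G) :
  \sum_j a j (c + a i (x j)) = c + a i (\sum_j a j (x j)).
Proof.
under eq_bigr do rewrite raddfD /= a_comm.
by rewrite big_split /= a_sum -raddf_sum.
Qed.

(** This point is the combination of the family with i-th entry w and all others z. *)
Lemma shift_in i z w : X z -> X w -> X (z + a i (w - z)).
Proof.
move=> Xz Xw; have := aX (update_in i Xw (fun=> Xz)).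
by rewrite (sum_update (fun j => a j)) a_sum -raddfB.
Qed.

Lemma subaffine_shift g i z w : subaffine S X a A g -> X z -> X w ->
  sg_le S (g (z + a i (w - z)) - g z) (A i (g w - g z)).
Proof.
move=> g_sub Xz Xw; have := g_sub _ (update_in i Xw (fun=> Xz)).
rewrite (sum_update (fun j => a j)) (sum_update (fun j => A j \o g)) /=.
by rewrite a_sum A_sum -!raddfB [g z + _]addrC => ?; exact/sg_leBDr.
Qed.

(* Apply the inequality twice, to the n x n array with entry x at (i, j), y at
   (j, i) and the midpoint z elsewhere: as a_i and a_j commute, the array is
   mapped to z, and A_i A_j can be cancelled in what remains. *)
Lemma subaffine_midconvex g x y : subaffine S X a A g -> X x -> X y ->
  sg_le S (g (ghalf (x + y)) *+ 2) (g x + g y).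
Proof.
move=> g_sub Xx Xy; set z := ghalf (x + y).
have Xz : X z := Xmid Xx Xy.
(* The indices 0 and 1, distinct and available as n >= 2; [u] and [v] are the combined rows i and j
   of the array, and the other rows give z. *)
pose i := Ordinal (ltnW n2); pose j := Ordinal n2.
pose u := z + a j (x - z); pose v := z + a i (y - z).
have Xu : X u := shift_in j Xz Xx.
have Xv : X v := shift_in i Xz Xy.
have := g_sub _ (update_in j Xv (update_in i Xu (fun=> Xz))).
rewrite (sum_update (fun j => a j)) (sum_update (fun j => A j \o g)).
rewrite (sum_update (fun j => a j)) (sum_update (fun j => A j \o g)).
rewrite /= a_sum A_sum -!raddfB -addrA.
have -> : a i (u - z) + a j (v - z) = 0.
  rewrite /u /v ![z + _]addrC !addrK (a_comm j) -!raddfD /= addrACA -opprD.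
  by rewrite -mulr2n ghalfK// subrr !raddf0.
rewrite addr0 /sg_le -(addrA (g z)) [g z + _]addrC addrK => uv_ge0.
have shift_le k l w : X w ->
    sg_le S (A k (g (z + a l (w - z)) - g z)) (A k (A l (g w - g z))).
  by move=> Xw; apply/A_le; exact: subaffine_shift.
have -> : g x + g y - g z *+ 2 = (g x - g z) + (g y - g z).
  by rewrite addrACA -opprD -mulr2n.
suff : sg_le S 0 (g x - g z + (g y - g z)) by rewrite /sg_le subr0.
apply/(A_le j)/(A_le i); rewrite !raddf0.
rewrite (raddfD (A j) (g x - g z)) (raddfD (A i) (A j (g x - g z))) /=.
rewrite (A_comm i j (g y - g z)).
have := sg_leD Sadd (shift_le i j x Xx) (shift_le j i y Xy).
apply: (sg_le_trans Sadd).
by rewrite /sg_le subr0.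
Qed.

Lemma dyadic_in p x m : X p -> X x -> X (p + dyadic m (x - p)).
Proof.
move=> Xp Xx; elim: m => [|m IHm]; first by rewrite /= addrC subrK.
by rewrite /= -(ghalf_midr G2); exact: Xmid.
Qed.

(** Each step is midconvexity at the previous point and p. The factor 2 ^ m stands on the left
    because halving is available in G only. *)
Lemma subaffine_dyadic g p x m : subaffine S X a A g -> X p -> X x ->
  sg_le S ((g (p + dyadic m (x - p)) - g p) *+ 2 ^ m) (g x - g p).
Proof.
move=> g_sub Xp Xx; elim: m => [|m IHm].
  by rewrite mulr1n /= [p + _]addrC subrK; exact: sg_lexx.
apply: (sg_le_trans Sadd _ IHm); rewrite expnS mulrnA; apply: sg_leMn => //.
have := subaffine_midconvex g_sub (dyadic_in m Xp Xx) Xp.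
by rewrite (ghalf_midr G2) /sg_le mulrnBl opprB [g p *+ 2]mulr2n !addrA subrK.
Qed.

(** For suitable m, p is the midpoint of w = p + (x - p)/2^m and q = p + (p - x)/2^m, both in X.
    Midconvexity with g p = f p and g q <= f q bounds g w below, and g x - g p dominates 2^m (g w -
    g p). *)
Lemma subaffine_lower_bound f p x : ri X p -> X x -> exists l : Y,
  forall g, subaffine S X a A g -> g p = f p ->
    (forall y, X y -> sg_le S (g y) (f y)) -> sg_le S l (g x).
Proof.
move=> [Xp ri_p] Xx; have [m _ Xq] := ri_p _ Xx.
set q := p + _ in Xq; exists (f p + (f p - f q) *+ 2 ^ m) => g g_sub gp gf.
set w := p + dyadic m (x - p).
have wq : ghalf (w + q) = p.
  apply: (mulr2_inj G2); rewrite ghalfK// /w /q -(opprB x p) dyadicN//.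
  by rewrite addrACA subrr addr0 mulr2n.
have := subaffine_midconvex g_sub (dyadic_in m Xp Xx) Xq.
rewrite -/w wq gp mulr2n => mid.
have := subaffine_dyadic m g_sub Xp Xx; rewrite -/w gp => gx.
have pq : sg_le S (f p - f q) (g w - f p).
  rewrite /sg_le opprB addrACA -opprD; apply: (sg_le_trans Sadd mid).
  by apply: sg_leD => //; [exact: sg_lexx|exact: gf].
rewrite /sg_le opprD addrA.
exact: (sg_le_trans Sadd (sg_leMn Sadd S0 (2 ^ m) pq) gx).
Qed.

(* The infima are taken in one summand at a time; each step only uses that A_k
   is an automorphism of the order, so no continuity of A_k is needed. *)
Lemma subaffine_chain_inf (C : set (G -> Y)) (h : G -> Y) : C !=set0 ->
  (forall g, C g -> subaffine S X a A g) ->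
  total_on C (fun g g' => forall x, X x -> sg_le S (g x) (g' x)) ->
  (forall x, X x -> sg_inf S [set g x | g in C] (h x)) ->
  subaffine S X a A h.
Proof.
move=> [g0 Cg0] C_sub C_tot h_inf x Xx.
have h_le g y : C g -> X y -> sg_le S (h y) (g y).
  by move=> Cg /h_inf[+ _]; apply; exists g.
set W := h _.
pose mix k (g : G -> Y) (i : 'I_n) :=
  if (i < k)%N then h (x i) else g (x i).
(* Induction on the number k of leading entries where h has replaced g; all entries are replaced at
   k = n. *)
suff WP k g : C g -> sg_le S W (\sum_(i < n) A i (mix k g i)).
  have := WP n g0 Cg0.
  by under eq_bigr do rewrite /mix ltn_ord.
elim: k g => [|k IHk] g Cg.
  exact: (sg_le_trans Sadd (h_le _ _ Cg (aX Xx)) (C_sub _ Cg x Xx)).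
have [nk|kn] := leqP n k.
  have := IHk g Cg; under eq_bigr do rewrite /mix (leq_trans (ltn_ord _) nk).
  by under [X in _ -> sg_le S W X]eq_bigr
    do rewrite /mix (leq_trans (ltn_ord _) (leqW nk)).
pose i0 := Ordinal kn; pose rest g := \sum_(i < n | i != i0) A i (mix k g i).
have mixS : \sum_(i < n) A i (mix k.+1 g i) = A i0 (h (x i0)) + rest g.
  rewrite (bigD1 i0)//= {1}/mix /= ltnSn; congr (_ + _).
  apply: eq_bigr => i /negPf i0i; rewrite /mix ltnS leq_eqVlt.
  by rewrite (_ : (i == k :> nat) = false).
have {}IHk g' : C g' -> sg_le S W (A i0 (g' (x i0)) + rest g').
  by move=> /IHk; rewrite (bigD1 i0)//= {1}/mix /= ltnn.
rewrite mixS; apply/sg_leBDr.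
(* With the other summands moved to the left and A_k inverted, the claim is that some element is
   below h(x_k); it suffices that it is below every g'(x_k). *)
have [B _ BK] := A_bij i0; rewrite -(BK (W - rest g)); apply/A_le.
apply: (h_inf _ (Xx i0)).2 => _ [g' Cg' <-]; apply/(A_le i0); rewrite BK.
(* The induction hypothesis is used for the smaller of g and g', whose values are then raised where
   the larger one occurs. *)
apply/sg_leBDr; have [gg'|g'g] := C_tot _ _ Cg Cg'.
  apply: (sg_le_trans Sadd (IHk g Cg)); apply: sg_leD => //.
    exact/A_le/gg'.
  exact: sg_lexx.
apply: (sg_le_trans Sadd (IHk g' Cg')); apply: sg_leD => //.
  exact: sg_lexx.
apply: sg_le_sum => // i _; apply/A_le; rewrite /mix; case: ifP => _.
  exact: sg_lexx.
exact: g'g.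
Qed.

(** * Existence of minimal minorants touching f at p *)

Definition touching_minorant (f : G -> Y) (p : G) (g : G -> Y) : Prop :=
  [/\ subaffine S X a A g, forall y, X y -> sg_le S (g y) (f y) & g p = f p].

Lemma minimal_touching_minorant f p : subaffine S X a A f -> ri X p ->
  exists2 g, touching_minorant f p g & forall g', touching_minorant f p g' ->
    (forall y, X y -> sg_le S (g' y) (g y)) -> forall y, X y -> g' y = g y.
Proof.
move=> f_sub pX; have Xp := pX.1.
pose T := {g | touching_minorant f p g}.
have f_minor : touching_minorant f p f.
  by split=> // y _; exact: sg_lexx.
(* The order is reversed, since Zorn's lemma gives maximal elements; it is only a preorder, since
   values outside X are free. *)
pose below (s t : T) := `[< forall y, X y -> sg_le S (sval t y) (sval s y) >].
have [|r s t /asboolP rs /asboolP st||[g g_minor] g_max] :=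
    @ZL_preorder T (exist _ f f_minor) below.
- by move=> t; apply/asboolP => y _; exact: sg_lexx.
- by apply/asboolP => y Xy; exact: (sg_le_trans Sadd (st y Xy) (rs y Xy)).
- move=> D D_tot; have [[t0 Dt0]|D0] := pselect (D !=set0); last first.
    by exists (exist _ f f_minor) => s Ds; case: D0; exists s.
  pose C := [set sval t | t in D].
  have Ct0 : C (sval t0) by exists t0.
  have C_minor g : C g -> touching_minorant f p g.
    by move=> [t _ <-]; exact: svalP.
  have C_tot : total_on C (fun g g' => forall x, X x -> sg_le S (g x) (g' x)).
    move=> _ _ [s Ds <-] [t Dt <-].
    by have [/asboolP|/asboolP] := D_tot _ _ Ds Dt; [right|left].
  (* Pointwise infima on X, with the arbitrary value 0 elsewhere. *)
  have /choice[h h_inf] x : exists m, X x -> sg_inf S [set g x | g in C] m.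
    have [Xx|nXx] := pselect (X x); last by exists 0.
    have [|||m m_inf] := @S_complete [set g x | g in C]; last by exists m.
    + by exists (sval t0 x), (sval t0).
    + move=> _ _ [g Cg <-] [g' Cg' <-].
      have [gg'|g'g] := C_tot _ _ Cg Cg'; first by left; exact: gg'.
      by right; exact: g'g.
    + have [l lP] := subaffine_lower_bound f pX Xx.
      by exists l => _ [g /C_minor[g_sub gf gp] <-]; exact: lP.
  have h_le g y : C g -> X y -> sg_le S (h y) (g y).
    by move=> Cg /h_inf[+ _]; apply; exists g.
  have [_ t0f t0p] := C_minor _ Ct0.
  have h_minor : touching_minorant f p h.
    split.
    + apply: (@subaffine_chain_inf C) => //; first by exists (sval t0).
      by move=> g /C_minor[].
    + by move=> y Xy; exact: (sg_le_trans Sadd (h_le _ _ Ct0 Xy) (t0f y Xy)).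
    + apply: S_anti; first by rewrite -t0p; exact: h_le.
      apply: (h_inf p Xp).2 => _ [g /C_minor[_ _ gp] <-].
      by rewrite gp; exact: sg_lexx.
  exists (exist _ h h_minor) => s Ds; apply/asboolP => y Xy.
  by apply: h_le => //; exists s.
exists g => // g' g'_minor g'g y Xy; apply: S_anti; first exact: g'g.
have /(_ _)/asboolP := g_max (exist _ g' g'_minor).
by apply=> //; apply/asboolP.
Qed.

(** * Minimality forces equality *)

Lemma minimal_update f p g (t : 'I_n -> G) (i : 'I_n) :
  touching_minorant f p g ->
  (forall g', touching_minorant f p g' ->
    (forall y, X y -> sg_le S (g' y) (g y)) -> forall y, X y -> g' y = g y) ->
  (forall j, X (t j)) -> t i = p ->
  g (\sum_j a j (t j)) = \sum_j A j (g (t j)) ->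
  forall x, X x -> g (\sum_j a j ([eta t with i |-> x] j)) =
                   \sum_j A j (g ([eta t with i |-> x] j)).
Proof.
move=> [g_sub gf gp] g_min Xt ti t_eq x Xx.
pose b := \sum_j a j (t j) - a i p; pose c := \sum_j A j (g (t j)) - A i (g p).
have a_upd y : \sum_j a j ([eta t with i |-> y] j) = b + a i y.
  by rewrite (sum_update (fun j => a j)) ti addrA addrAC.
have A_upd y : \sum_j A j (g ([eta t with i |-> y] j)) = c + A i (g y).
  by rewrite (sum_update (fun j => A j \o g)) /= ti addrA addrAC.
have Xb y : X y -> X (b + a i y).
  by move=> Xy; rewrite -a_upd; apply: aX; exact: update_in.
have [B AK BK] := A_bij i; pose g' y := B (g (b + a i y) - c).
have g'_le y : X y -> sg_le S (g' y) (g y).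
  move=> Xy; apply/(A_le i); rewrite BK; apply/sg_leBDr.
  by rewrite [A i _ + _]addrC -A_upd -a_upd; apply: g_sub; exact: update_in.
have g'_minor : touching_minorant f p g'.
  split=> [y Xy|y Xy|].
  (* After applying A_i, this is the inequality for g at the points b + a_i x_j, shifted by c on
     both sides: the A_j commute with A_i, and the A_j c sum to c. *)
  - apply/(A_le i); rewrite BK -comb_sum [A i _]raddf_sum /=.
    under [X in sg_le S _ X]eq_bigr do rewrite A_comm BK raddfB /=.
    rewrite sumrB A_sum; apply/sg_leD2r.
    by apply: g_sub => j; exact: Xb.
  - exact: (sg_le_trans Sadd (g'_le y Xy) (gf y Xy)).
  (* At p, b + a_i p is the combination of t, so the equality for t leaves A_i (g p) under the
     inverse of A_i. *)
  - rewrite /g' /b subrK t_eq /c opprB addrC subrK AK; exact: gp.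
have := g_min g' g'_minor g'_le x Xx => /(congr1 (A i)).
by rewrite BK a_upd A_upd => <-; rewrite subrKC.
Qed.

Lemma minimal_affine f p g : X p -> touching_minorant f p g ->
  (forall g', touching_minorant f p g' ->
    (forall y, X y -> sg_le S (g' y) (g y)) -> forall y, X y -> g' y = g y) ->
  forall x : 'I_n -> G, (forall i, X (x i)) ->
    g (\sum_(i < n) a i (x i)) = \sum_(i < n) A i (g (x i)).
Proof.
move=> Xp g_minor g_min x Xx.
(* Only the first k entries may differ from p; for k = 0 both sides equal g p. *)
suff tP k t : (forall j, X (t j)) -> (forall j : 'I_n, (k <= j)%N -> t j = p) ->
    g (\sum_j a j (t j)) = \sum_j A j (g (t j)).
  by apply: (tP n) => // j; rewrite leqNgt ltn_ord.
elim: k t => [|k IHk] t Xt tp.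
  by under eq_bigr do rewrite tp//; under [RHS]eq_bigr do rewrite tp//;
    rewrite a_sum A_sum.
have [nk|kn] := leqP n k.
  by apply: IHk => // j; rewrite leqNgt (leq_trans (ltn_ord _) nk).
(* Entry k is reset to p, where the induction hypothesis applies, and then restored by
   [minimal_update]. *)
pose i := Ordinal kn; pose t' := [eta t with i |-> p].
have t'_eq : g (\sum_j a j (t' j)) = \sum_j A j (g (t' j)).
  apply: IHk => [|j kj]; first exact: update_in.
  rewrite /t' /=; case: eqVneq => // ij; apply: tp.
  by rewrite ltn_neqAle kj andbT eq_sym.
have t'i : t' i = p by rewrite /t' /= eqxx.
have tE j : [eta t' with i |-> t i] j = t j.
  by rewrite /t' /=; case: eqP => [->|].
have := minimal_update g_minor g_min (update_in i Xp Xt) t'i t'_eq (Xt i).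
by under eq_bigr do rewrite tE; under [X in _ = X -> _]eq_bigr do rewrite tE.
Qed.

End Subaffine.

Theorem theorem4p8 (R : realType)
  (G : zmodType) (G2 : uniquely_2_divisible G)
  (X : set G) (Xmid : midconvex X)
  (Y : metricZmodType R) (Ycomplete : complete_space Y)
  (S : set Y) (Sadd : subsemigroup S) (S0 : S 0) (Sclosed : closed S)
  (Sctrl : additively_controllable S)
  (n : nat) (n2 : (2 <= n)%N)
  (a : 'I_n -> {additive G -> G}) (A : 'I_n -> {additive Y -> Y})
  (a_comm : forall i j, a i \o a j = a j \o a i)
  (A_comm : forall i j, A i \o A j = A j \o A i)
  (a_sum : (fun x : G => \sum_(i < n) a i x) = id)
  (A_sum : (fun y : Y => \sum_(i < n) A i y) = id)
  (aX : [set \sum_(i < n) a i (x i) | x in [set x : 'I_n -> G | forall i, X (x i)]]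
          `<=` X)
  (A_bij : forall i, bijective (A i))
  (A_S : forall i, A i @` S = S)
  (f : G -> Y)
  (f_convex : forall x : 'I_n -> G, (forall i, X (x i)) ->
     sg_le S (f (\sum_(i < n) a i (x i))) (\sum_(i < n) A i (f (x i))))
  (p : G) (pX : ri X p) :
  exists g : G -> Y,
    [/\ forall x, X x -> sg_le S (g x) (f x),
        g p = f p &
        forall x : 'I_n -> G, (forall i, X (x i)) ->
          g (\sum_(i < n) a i (x i)) = \sum_(i < n) A i (g (x i))].
Proof.
have a_comm' i j x : a i (a j x) = a j (a i x).
  exact: (congr1 (@^~ x) (a_comm i j)).
have A_comm' i j y : A i (A j y) = A j (A i y).
  exact: (congr1 (@^~ y) (A_comm i j)).
have a_sum' x : \sum_(i < n) a i x = x by exact: (congr1 (@^~ x) a_sum).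
have A_sum' y : \sum_(i < n) A i y = y by exact: (congr1 (@^~ y) A_sum).
have aX' (x : 'I_n -> G) : (forall i, X (x i)) -> X (\sum_(i < n) a i (x i)).
  by move=> Xx; apply: aX; exists x.
have S_anti := controllable_le_anti Sctrl.
have S_complete := controllable_chain_complete Sadd S0 Ycomplete Sclosed Sctrl.
have [g g_minor g_min] := minimal_touching_minorant G2 Xmid Sadd S0 S_anti
  S_complete n2 a_comm' A_comm' a_sum' A_sum' aX' A_bij A_S f_convex pX.
exists g; case: (g_minor) => _ gf gp; split=> //.
exact: (minimal_affine Sadd a_comm' A_comm' a_sum' A_sum' aX' A_bij A_S pX.1
  g_minor g_min).
Qed.
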